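(* Let $a,b,c,d$ be positive integers such that $\gcd(a,b,c,d)=1$, $a\ne b$, $c\neq d$, and $a+b=c+d$; set $M:=a+b=c+d$, and let $q$ and $r$ be the additive orders of $a$ and $c$, respectively, modulo $M$. \begin{enumerate} \item If $\gcd(a,b)\neq\gcd(c,d)$ and at least one of $q,r$ is odd, then there are no $(a,b,c,d)$-hitomezashi patterns. \item If $\gcd(a,b)\ne\gcd(c,d)$ and $q,r$ are both even, then every $(a,b,c,d)$-hitomezashi pattern consists entirely of rectangles (and such patterns are exactly those of the form $\varphi(\vec x)$ with $\vec x\in\mathcal X_{(a,b,c,d)}$, for the bijective parameterization $\varphi$ defined in the context), and the number of such patterns is $2^{M/q+M/r}\cdot(M/2)!$. \item If $\gcd(a,b)=\gcd(c,d)$ and at least one of $q,r$ is odd, then every $(a,b,c,d)$-hitomezashi pattern consists entirely of zig-zags of a single type, and the number of such patterns is $2M$. \item If $\gcd(a,b)=\gcd(c,d)$ and $q,r$ are both even, then every $(a,b,c,d)$-hitomezashi pattern consists either entirely of rectangles (and such patterns are exactly those of the form $\varphi(\vec x)$ with $\vec x\in\mathcal X_{(a,b,c,d)}$, bijectively) or entirely of zig-zags of a single type, and the total number of $(a,b,c,d)$-hitomezashi patterns is $2^{M/q+M/r}\cdot(M/2)!+2M$. \end{enumerate}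
   Context: For $u,v\in\mathbb R^2$, $[u,v]$ is the line segment with endpoints $u,v$. Let $a,b,c,d$ be positive integers. Assign to each $i\in\mathbb Z$ a label $\varepsilon_i\in\mathbb Z/(a+b)\mathbb Z$ and to each $j\in\mathbb Z$ a label $\eta_j\in\mathbb Z/(c+d)\mathbb Z$. The horizontal stitches on the line $y=i$ are the segments $[(k,i),(k+a,i)]$ with $k\equiv\varepsilon_i\pmod{a+b}$; the vertical stitches on the line $x=j$ are the segments $[(j,k),(j,k+c)]$ with $k\equiv\eta_j\pmod{c+d}$. The resulting arrangement of stitches is an $(a,b,c,d)$-hitomezashi pattern if every endpoint of a vertical stitch is an endpoint of a horizontal stitch and vice versa. View the stitches as edges of a graph whose vertices are the endpoints of stitches; its connected components are called strands. A rectangle is a strand that is a cycle consisting of four stitches. A positive (respectively, negative) zig-zag is an infinite strand that can be oriented so that its stitches are alternately oriented west-to-east and south-to-north (respectively, west-to-east and north-to-south). The type of a zig-zag is positive or negative accordingly. Parameterization $\varphi$ (for $q,r$ even, where $q,r$ are the additive orders of $a,c$ modulo $M=a+b=c+d$): let $\mathcal X_{(a,b,c,d)}:=\{0,1\}^{M/q}\times\{0,1\}^{M/r}\times S_{M/2}$, where $S_n$ is the set of permutations of $[n]=\{1,\dots,n\}$. For $\vec x=((u_1,\dots,u_{M/q}),(v_1,\dots,v_{M/r}),\sigma)\in\mathcal X_{(a,b,c,d)}$ and each $1\le i\le M/q$, let $\hat u(i)$ be the sequence $i+u_ia,\ i+(u_i+2)a,\ i+(u_i+4)a,\dots,i+(u_i+q-2)a$,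 and let $\widetilde u=\widetilde u_1\cdots\widetilde u_{M/2}$ be the concatenation $\hat u(1)\hat u(2)\cdots\hat u(M/q)$. Similarly, for $1\le j\le M/r$ let $\hat v(j)$ be the sequence $j+v_jc,\ j+(v_j+2)c,\dots,j+(v_j+r-2)c$, and let $\widetilde v=\widetilde v_1\cdots\widetilde v_{M/2}$ be the concatenation $\hat v(1)\cdots\hat v(M/r)$. Then $\varphi(\vec x)$ is the $(a,b,c,d)$-hitomezashi pattern consisting entirely of rectangles whose set of southwest corners of rectangles is $\{(\widetilde u_1,\widetilde v_{\sigma(1)}),\dots,(\widetilde u_{M/2},\widetilde v_{\sigma(M/2)})\}+M\cdot\mathbb Z^2$. *)

(* Defs.v *)
From Stdlib Require Import Relation_Operators.
From HB Require Import structures.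
From mathcomp Require Import all_boot all_order all_algebra all_fingroup.
From mathcomp Require Import mathcomp_extra boolp classical_sets cardinality.

Set Implicit Arguments.
Unset Strict Implicit.
Unset Printing Implicit Defensive.

Import Order.TTheory GRing.Theory Num.Theory.

Local Open Scope classical_set_scope.
Local Open Scope ring_scope.

Definition gridpoint : Type := (int * int)%type.

(* A stitch is recorded by its two endpoints, the west (resp. south) endpoint
   first; since a, c > 0 this determines the segment and vice versa. *)
Definition stitch : Type := (gridpoint * gridpoint)%type.

Definition hstitches (a b : nat) (eps : int -> 'Z_(a + b)) : set stitch :=
  [set s | exists i k : int,
     k%:~R = eps i /\ s = ((k, i), (k + a%:Z, i))].

Definition vstitches (c d : nat) (eta : int -> 'Z_(c + d)) : set stitch :=
  [set s | exists j k : int,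
     k%:~R = eta j /\ s = ((j, k), (j, k + c%:Z))].

Definition endpoints (P : set stitch) : set gridpoint :=
  [set p | exists2 s, P s & p = s.1 \/ p = s.2].

(* A pattern is the arrangement of stitches itself, not the labelling. *)
Definition hitomezashi (a b c d : nat) (P : set stitch) : Prop :=
  exists (eps : int -> 'Z_(a + b)) (eta : int -> 'Z_(c + d)),
    [/\ P = hstitches eps `|` vstitches eta,
        endpoints (vstitches eta) `<=` endpoints (hstitches eps) &
        endpoints (hstitches eps) `<=` endpoints (vstitches eta)].

Definition edge (P : set stitch) (p q : gridpoint) : Prop := P (p, q) \/ P (q, p).

(* A strand is given by its set of vertices; its edges are the stitches of P
   incident to them. *)
Definition strand (P : set stitch) (S : set gridpoint) : Prop :=
  exists2 p, endpoints P p & S = [set q | clos_refl_trans gridpoint (edge P) p q].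

Definition rectangle (P : set stitch) (S : set gridpoint) : Prop :=
  strand P S /\
  exists s : seq gridpoint,
    [/\ size s = 4%N, uniq s, S = [set p | p \in s] &
        forall p q, p \in s -> (edge P p q <-> q = next s p \/ q = prev s p)].

Definition west_to_east (p q : gridpoint) : Prop := p.2 = q.2 /\ p.1 < q.1.
Definition south_to_north (p q : gridpoint) : Prop := p.1 = q.1 /\ p.2 < q.2.

(* The orientation is a traversal w of the strand; every vertex of a
   hitomezashi pattern has degree 2, so an infinite strand is two-way infinite.
   [positive = false] gives the negative zig-zags. *)
Definition zigzag (positive : bool) (P : set stitch) (S : set gridpoint) : Prop :=
  [/\ strand P S, infinite_set S &
      exists w : int -> gridpoint,
        [/\ S = range w,
            forall n q, edge P (w n) q <-> q = w (n + 1) \/ q = w (n - 1),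
            forall m : int, west_to_east (w (2 * m)) (w (2 * m + 1)) &
            forall m : int,
              if positive then south_to_north (w (2 * m + 1)) (w (2 * m + 2))
              else south_to_north (w (2 * m + 2)) (w (2 * m + 1))]].

Definition all_rectangles (P : set stitch) : Prop :=
  forall S, strand P S -> rectangle P S.

Definition all_zigzags_single_type (P : set stitch) : Prop :=
  exists positive : bool, forall S, strand P S -> zigzag positive P S.

Definition sw_corner (S : set gridpoint) (p : gridpoint) : Prop :=
  S p /\ forall q, S q -> p.1 <= q.1 /\ p.2 <= q.2.

Definition sw_corners (P : set stitch) : set gridpoint :=
  [set p | exists2 S, rectangle P S & sw_corner S p].

(* The finite group structure on 'Z_M is the additive one. *)
Definition addorder (M a : nat) : nat := #[(a%:R : 'Z_M)]%g.

(* The set X_(a,b,c,d), with M = a + b = c + d. *)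
Definition param (M a c : nat) : Type :=
  ({ffun 'I_(M %/ addorder M a) -> bool} *
   {ffun 'I_(M %/ addorder M c) -> bool} *
   'S_(M %/ 2))%type.

(* The concatenation of the sequences
     i + u_i a, i + (u_i + 2) a, ..., i + (u_i + q - 2) a   (1 <= i <= M / q);
   ordinals count from 0, hence the successor. *)
Definition tilde (M a : nat) (u : {ffun 'I_(M %/ addorder M a) -> bool}) :
    seq int :=
  flatten [seq [seq (i.+1 + (u i + 2 * k) * a)%N%:Z
                  | k <- iota 0 (addorder M a %/ 2)]
             | i : 'I_(M %/ addorder M a) <- enum 'I_(M %/ addorder M a)].

Definition phi_corners (M a c : nat) (x : param M a c) : set gridpoint :=
  let: (u, v, sigma) := x in
  [set p | exists (l : 'I_(M %/ 2)) (m n : int),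
     p = ((tilde u)`_l + M%:Z * m, (tilde v)`_(sigma l) + M%:Z * n)].

Definition phi_spec (a b c d : nat) (x : param (a + b) a c) (P : set stitch) :
    Prop :=
  [/\ hitomezashi a b c d P, all_rectangles P &
      sw_corners P = phi_corners x].

Arguments phi_spec a b c d x P : clear implicits.

(* The pattern described by phi_spec; the value set0 is never used once
   phi_spec is known to have a unique solution. *)
Definition phi (a b c d : nat) (x : param (a + b) a c) : set stitch :=
  xget set0 [set P | phi_spec a b c d x P].

Arguments phi a b c d x : clear implicits.

(* Main.v *)
Require Import Defs.
From Stdlib Require Import Relation_Operators.
From mathcomp Require Import all_boot all_order all_algebra all_fingroup all_solvable.
From mathcomp Require Import mathcomp_extra boolp classical_sets functions cardinality.
From mathcomp Require Import zify ring.

(** Up to periodicity a pattern lives on a torus.  The endpoint condition says that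
    the set of endpoints has two points e i and e i + a in each row i, and two
    points f j and f j + c in each column j.  Since 2 a is nonzero modulo M (as a
    differs from b), these two points determine e i, so that labels of congruent
    rows agree; likewise for columns.  A pattern thus amounts to a pair of maps
    e, f on the residues modulo M satisfying [compat] ([hitomezashiE]).

    Look at the two vertices of a row.  If their vertical stitches go the same way,
    the row belongs to a rectangle.  If one goes up and the other down, the
    condition forces the next row of the strand to behave in the same manner, with
    label shifted by a ([zigzag_row_step]): rows advance by c, or by - c for the
    negative type, and columns by a.  Closing up on the torus needs equally many
    steps in both directions, so the orders q and r of a and c coincide.  As
    gcd (a, b) = M / q and gcd (c, d) = M / r, a zig-zag forces these two divisors
    to be equal, hence equal to 1; then a and c are units modulo M, the one strand
    visits all rows, and its type and the label of row 0 determine the pattern.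
    Conversely every choice of these works, which gives 2 M patterns.  There is
    accordingly no pattern mixing rectangles with zig-zags, or zig-zags of
    different types ([hitomezashi_cases]).

    If all rows are rectangular, lower and upper sides alternate along multiples of
    c, and left and right sides along multiples of a.  An alternating set exists on
    a cycle only if its length is even, so q and r are even ([rectangular_even]).
    Such a pattern is determined by its southwest corners, and these amount to an
    alternating set of left columns, an alternating set of bottom rows, and a
    bijection between the two; any such data occur ([matching_pattern]).  An
    alternating set is a choice of one of two halves of each of the M / q (or
    M / r) cosets, so the data are two bit vectors and a permutation of M / 2
    objects, which is the parameterization phi ([param_pattern], [pattern_param],
    [param_corner_inj]).

    The rest transfers this to the plane: the strands of rectangular patterns are
    the lifted squares ([square_strand]) and those of zig-zag patterns are infinite
    walks ([walk_strand]); the latter are therefore never rectangles, and the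
    numbers of the two families add. *)

(** * Labellings of a torus *)

Section TorusPatterns.
Set Implicit Arguments.
Unset Strict Implicit.
Local Open Scope ring_scope.
Import GRing.Theory.
Context {Z : zmodType}.
Implicit Types (a c i j : Z) (e f : Z -> Z).

(** The endpoint condition read on the torus: e and f give the west ends of the
    horizontal stitches in each row and the south ends of the vertical stitches
    in each column, and the point in column j and row i must be an endpoint of
    stitches of both kinds or of neither. *)
Definition compat a c e f : Prop :=
  forall i j, (j = e i \/ j = e i + a) <-> (i = f j \/ i = f j + c).

(** Since e i and e i + a are the two vertices in row i, equality of their labels
    says that the two vertical stitches leaving row i go the same way, both up
    or both down; they are then opposite sides of a rectangle. *)
Definition rectangular a e f : Prop := forall i, f (e i) = f (e i + a).

(** The row is crossed by a strand climbing from west to east: its west vertex is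
    the top of a vertical stitch and its east vertex the bottom of one. *)
Definition zigzag_row a c e f i : Prop := f (e i) + c = i /\ f (e i + a) = i.

Lemma addr_eql i j : i + j = i -> j = 0.
Proof. by move=> h; rewrite -(addKr i j) h addNr. Qed.

Lemma double_neq0 i : i + i <> 0 -> i <> 0.
Proof. by move=> h i0; apply: h; rewrite i0 addr0. Qed.

(** Reflection in the diagonal. *)
Lemma compat_sym a c e f : compat a c e f -> compat c a f e.
Proof. by move=> ef j i; split=> h; apply/ef. Qed.

(** Reflection in a horizontal line: bottoms of vertical stitches become tops, so
    the label of a column moves by c while c changes sign.  Everything about
    climbing zig-zags thereby applies to descending ones. *)
Lemma compat_flip a c e f :
  compat a c e f -> compat a (- c) e (fun j => f j + c).
Proof. by move=> ef i j; rewrite addrK ef or_comm. Qed.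

Definition orient (V : zmodType) (up : bool) (v : V) : V := if up then v else - v.

(** With orient up c, the labels of the pattern itself (up = true) or of its
    reflection (up = false), in which a descending zig-zag climbs. *)
Definition orient_label (up : bool) c f : Z -> Z :=
  fun j => if up then f j else f j + c.

Definition zigzag_pattern (up : bool) a c e f : Prop :=
  forall i, zigzag_row a (orient up c) e (orient_label up c f) i.

Lemma compat_orient up a c e f :
  compat a c e f -> compat a (orient up c) e (orient_label up c f).
Proof. by case: up => //; exact: compat_flip. Qed.

Lemma orient_double up c : c + c <> 0 -> orient up c + orient up c <> 0.
Proof. by case: up => //= c2; rewrite -opprD => /eqP; rewrite oppr_eq0 => /eqP. Qed.

(** Each of the two vertices in row i continues either up or down: both the same
    way, or in one of the two zig-zag manners. *)
Lemma row_cases a c e f i : compat a c e f ->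
  f (e i) = f (e i + a) \/
  exists up, zigzag_row a (orient up c) e (orient_label up c f) i.
Proof.
move=> ef; rewrite /zigzag_row /orient_label.
have [/esym fL | /esym fL] : i = f (e i) \/ i = f (e i) + c by apply/ef; left.
all: have [/esym fR | /esym fR] : i = f (e i + a) \/ i = f (e i + a) + c
  by apply/ef; right.
- by left; rewrite fL.
- by right; exists false; rewrite addrK.
- by right; exists true.
- by left; apply: (addIr c); rewrite fL.
Qed.

(** Going up from the east vertex of a zig-zag row leads to column e i + a of row
    i + c.  If that were again an east vertex, the west vertex of row i + c would
    sit in column e i, which already has the two rows i - c and i.  So it is a
    west vertex, and the next vertex east cannot continue downwards, because row
    i has no third vertex. *)
Lemma zigzag_row_step a c e f i : a + a <> 0 -> c + c <> 0 -> compat a c e f ->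
  zigzag_row a c e f i -> e (i + c) = e i + a /\ zigzag_row a c e f (i + c).
Proof.
move=> a2 c2 ef [fL fR].
have step : e (i + c) = e i + a.
  have [//|/addIr eq_e] : e i + a = e (i + c) \/ e i + a = e (i + c) + a.
    by apply/ef; right; rewrite fR.
  have : i + c = f (e i) \/ i + c = f (e i) + c by apply/ef; left.
  case=> [ic | ]; last by rewrite fL => /addr_eql /(double_neq0 c2).
  by move: fL; rewrite -ic -addrA => /addr_eql.
split=> //; split; first by rewrite step fR.
have : i + c = f (e (i + c) + a) \/ i + c = f (e (i + c) + a) + c
  by apply/ef; right.
case=> [//|/addIr iE].
have : e (i + c) + a = e i \/ e (i + c) + a = e i + a by apply/ef; left.
by rewrite step -addrA => -[/addr_eql|/addrI/addr_eql/(double_neq0 a2)].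
Qed.

Lemma zigzag_row_iter a c e f i k : a + a <> 0 -> c + c <> 0 ->
  compat a c e f -> zigzag_row a c e f i ->
  e (i + c *+ k) = e i + a *+ k /\ zigzag_row a c e f (i + c *+ k).
Proof.
move=> a2 c2 ef zi; elim: k => [|k [IHe IHz]]; first by rewrite !mulr0n !addr0.
rewrite !mulrSr !addrA -IHe; exact: zigzag_row_step.
Qed.

(** After k steps the strand has moved by k times a and k times c.  A row has one
    west vertex and a column one label, so returning to the row of departure
    forces a return to the column of departure, and conversely. *)
Lemma zigzag_row_periods a c e f i k : a + a <> 0 -> c + c <> 0 ->
  compat a c e f -> zigzag_row a c e f i -> (a *+ k = 0 <-> c *+ k = 0).
Proof.
move=> a2 c2 ef zi; have [step [_ fR]] := zigzag_row_iter k a2 c2 ef zi.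
have [fL fR0] := zi.
split=> k0; last by move: step; rewrite k0 addr0 => /esym/addr_eql.
by move: fR; rewrite step k0 addr0 fR0 => /esym/addr_eql.
Qed.

(** The rows f (e i) and f (e i) + c both meet the two columns e i and e i + a,
    hence have the same label as row i. *)
Lemma rectangular_shift a c e f i : a + a <> 0 -> compat a c e f ->
  rectangular a e f -> e (f (e i) + c) = e i /\ e (f (e i)) = e i.
Proof.
move=> a2 ef rect.
suff eqe r : r = f (e i) \/ r = f (e i) + c -> e r = e i.
  by split; apply: eqe; [right | left].
move=> hr; have [//|eL] : e i = e r \/ e i = e r + a by apply/ef.
have : e i + a = e r \/ e i + a = e r + a by apply/ef; rewrite -rect.
by rewrite {}eL -addrA => -[/addr_eql|/addrI/addr_eql/(double_neq0 a2)].
Qed.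

(** Rectangularity of all rows is rectangularity of all columns: a rectangle does
    not distinguish its horizontal sides from its vertical ones. *)
Lemma rectangular_sym a c e f : a + a <> 0 -> compat a c e f ->
  rectangular a e f -> rectangular c f e.
Proof.
move=> a2 ef rect j.
have fj : f j = f (e (f j)).
  have [<-//|jE] : j = e (f j) \/ j = e (f j) + a by apply/ef; left.
  by rewrite {1}jE -rect.
by have [+ _] := rectangular_shift (f j) a2 ef rect; rewrite -fj.
Qed.

(** U is a union of every other point of each coset of the subgroup spanned by a. *)
Definition alternating a (U : pred Z) : Prop := forall j, U (j + a) = ~~ U j.

Lemma alternatingMn a U j k : alternating a U -> U (j + a *+ k) = odd k (+) U j.
Proof.
move=> altU; elim: k => [|k IHk]; first by rewrite mulr0n addr0.
by rewrite mulrSr addrA altU IHk /= addNb.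
Qed.

(** Walking k steps around a cycle flips membership k times, so alternating sets
    exist only on cycles of even length: the source of the parity conditions. *)
Lemma alternating_period a U k : alternating a U -> a *+ k = 0 -> ~~ odd k.
Proof.
move=> altU k0; have := alternatingMn 0 k altU.
by rewrite k0 addr0; case: (odd k) (U 0) => -[].
Qed.

Lemma alternatingB a U j : alternating a U -> U (j - a) = ~~ U j.
Proof. by move=> altU; rewrite -{2}(subrK a j) altU negbK. Qed.

(** Row i contains the lower side, and not the upper side, of its rectangle. *)
Definition bottom e f : pred Z := fun i => f (e i) == i.

(** The row above the lower side of a rectangle contains the upper side of the
    same rectangle.  If rows i and i + c were both upper sides, then row i would
    be the lower side belonging to row i + c. *)
Lemma bottom_alternating a c e f : a + a <> 0 -> c + c <> 0 ->
  compat a c e f -> rectangular a e f -> alternating c (bottom e f).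
Proof.
move=> a2 c2 ef rect i; rewrite /bottom.
have [eT eB] := rectangular_shift i a2 ef rect.
have [/esym fe | fe] : i = f (e i) \/ i = f (e i) + c by apply/ef; left.
  move: eT; rewrite fe eqxx /= => ->; rewrite fe.
  by apply/eqP => /esym/addr_eql/(double_neq0 c2).
have topi : f (e i) != i.
  by apply/eqP => fei; move: fe; rewrite fei => /esym/addr_eql/(double_neq0 c2).
rewrite topi; apply/eqP.
have [//|/addIr iE] : i + c = f (e (i + c)) \/ i + c = f (e (i + c)) + c
  by apply/ef; left.
have [_] := rectangular_shift (i + c) a2 ef rect.
by rewrite -iE => eE; move: topi; rewrite eE -iE eqxx.
Qed.

(** A southwest corner is a point that is both a west end and a south end. *)
Definition corner e f j i : Prop := j = e i /\ i = f j.

Lemma corner_bottom e f i : corner e f (e i) i <-> bottom e f i.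
Proof. by split=> [[_ /esym/eqP]|/eqP /esym]. Qed.

(** A bottom row gets its label from its corner; any other row lies c above a
    bottom row and shares its label. *)
Lemma corners_determine_labels a c e f e' f' : a + a <> 0 -> c + c <> 0 ->
  compat a c e f -> rectangular a e f ->
  compat a c e' f' -> rectangular a e' f' ->
  (forall j i, corner e f j i <-> corner e' f' j i) -> e =1 e'.
Proof.
move=> a2 c2 ef rect ef' rect' W.
have eqb i : bottom e f i -> e i = e' i by move/corner_bottom/W => [].
move=> i; have [/eqb //|topi] := boolP (bottom e f i).
have lo : bottom e f (i - c).
  by rewrite (alternatingB i (bottom_alternating a2 c2 ef rect)).
have lo' : bottom e' f' (i - c).
  by apply/corner_bottom; rewrite -(eqb _ lo); apply/W/corner_bottom.
have := rectangular_shift (i - c) a2 ef rect.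
have := rectangular_shift (i - c) a2 ef' rect'.
rewrite (eqP lo) (eqP lo') subrK => -[-> _] [-> _]; exact: eqb.
Qed.

(** Conversely to the extraction of corners: choose left columns U and bottom rows
    V, alternating, and match them by mutually inverse maps g and h.  Rounding a
    row down to the bottom row below it (lo), and a column to the left column
    (le), turns the endpoint condition into h (lo i) = le j on one side and
    g (le j) = lo i on the other. *)
Lemma matching_pattern a c (U V : pred Z) (g h : Z -> Z) :
  alternating a U -> alternating c V ->
  (forall j, U j -> V (g j) /\ h (g j) = j) ->
  (forall i, V i -> U (h i) /\ g (h i) = i) ->
  exists e f, [/\ compat a c e f, rectangular a e f &
    forall j i, corner e f j i <-> U j /\ i = g j].
Proof.
move=> altU altV gP hP.
pose lo i := if V i then i else i - c.
pose le j := if U j then j else j - a.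
have Vlo i : V (lo i).
  by rewrite /lo; case: ifPn => // Vi; rewrite (alternatingB i altV).
have Ule j : U (le j).
  by rewrite /le; case: ifPn => // Uj; rewrite (alternatingB j altU).
have loP i k : V k -> (i = k \/ i = k + c) <-> lo i = k.
  move=> Vk; split=> [[->|->]|]; rewrite /lo.
  - by rewrite Vk.
  - by rewrite altV Vk /= addrK.
  - by case: ifP => _ <-; [left | right; rewrite subrK].
have leP j k : U k -> (j = k \/ j = k + a) <-> le j = k.
  move=> Uk; split=> [[->|->]|]; rewrite /le.
  - by rewrite Uk.
  - by rewrite altU Uk /= addrK.
  - by case: ifP => _ <-; [left | right; rewrite subrK].
have gV j : V (g (le j)) by case: (gP _ (Ule j)).
have hU i : U (h (lo i)) by case: (hP _ (Vlo i)).
exists (h \o lo), (g \o le); split=> [i j|i|j i] /=.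
- rewrite (leP _ _ (hU i)) (loP _ _ (gV j)).
  by split=> ->; [case: (hP _ (Vlo i)) | case: (gP _ (Ule j))].
- by congr g; rewrite !((leP _ _ (hU i)).1 _) //; [right | left].
- split=> [[/= jE iE]|[Uj ->]].
    have Uj : U j by rewrite jE.
    by split=> //; rewrite iE /le Uj.
  have [Vg hg] := gP _ Uj.
  by rewrite /corner /= /le /lo Uj Vg hg.
Qed.

End TorusPatterns.

(** * Periodic patterns in the plane *)

Section PlanePatterns.
Set Implicit Arguments.
Unset Strict Implicit.
Local Open Scope classical_set_scope.
Local Open Scope ring_scope.
Import Order.TTheory GRing.Theory Num.Theory.
Context {M : nat} (a c : nat).
Implicit Types (e f : 'Z_M -> 'Z_M) (x y m n : int) (p q : gridpoint).

(** The arrangement in the plane whose labels depend only on the residues of the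
    rows and columns. *)
Definition plane_pattern e f : set stitch :=
  [set s | exists x y, (x%:~R = e y%:~R /\ s = ((x, y), (x + a%:Z, y))) \/
                       (y%:~R = f x%:~R /\ s = ((x, y), (x, y + c%:Z)))].

Lemma intr_surj (z : 'Z_M) : exists x, x%:~R = z.
Proof. by exists (z : nat)%:Z; exact: (natr_Zp z). Qed.

Lemma intr_nat (n : nat) : (n%:Z)%:~R = n%:R :> 'Z_M.
Proof. by []. Qed.

Lemma endpoints_plane e f x y : compat a%:R c%:R e f ->
  endpoints (plane_pattern e f) (x, y) <->
  (x%:~R = e y%:~R \/ x%:~R = e y%:~R + a%:R).
Proof.
move=> ef; split.
  move=> [s [x' [y' [[h ->]|[h ->]]]]] /= [] [-> ->].
  - by left.
  - by right; rewrite intrD h.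
  - by apply/ef; left.
  - by apply/ef; right; rewrite intrD h.
case=> h.
  by exists ((x, y), (x + a%:Z, y)); [exists x, y; left | left].
exists ((x - a%:Z, y), (x, y)); last by right.
exists (x - a%:Z), y; left; split; first by rewrite rmorphB /= h addrK.
by rewrite subrK.
Qed.

(** The booleans l and b tell whether (x, y) is a west end and a south end.  A
    vertex is thereby incident to exactly one stitch of each direction. *)
Lemma edge_plane e f x y (l b : bool) q : (0 < a)%N -> (0 < c)%N ->
  a%:R <> 0 :> 'Z_M -> c%:R <> 0 :> 'Z_M ->
  x%:~R = e y%:~R + (if l then 0 else a%:R) ->
  y%:~R = f x%:~R + (if b then 0 else c%:R) ->
  edge (plane_pattern e f) (x, y) q <->
  (q = (x + (if l then a%:Z else - a%:Z), y) \/ q = (x, y + (if b then c%:Z else - c%:Z))).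
Proof.
move=> a_gt0 c_gt0 a0 c0 hx hy; split.
  case=> -[x' [y' [[h [? ? ?]]|[h [? ? ?]]]]]; subst.
  - left; case: l hx => // /eqP; rewrite h -subr_eq0 opprD addrA subrr sub0r oppr_eq0.
    by move/eqP.
  - right; case: b hy => // /eqP; rewrite h -subr_eq0 opprD addrA subrr sub0r oppr_eq0.
    by move/eqP.
  - left; case: l hx => [|_]; last by rewrite addrK.
    by rewrite intrD h addr0 => /addr_eql.
  - right; case: b hy => [|_]; last by rewrite addrK.
    by rewrite intrD h addr0 => /addr_eql.
case=> ->.
- case: l hx => hx; [left | right; rewrite /plane_pattern].
    by exists x, y; left; rewrite hx addr0.
  by exists (x - a%:Z), y; left; rewrite rmorphB /= hx addrK subrK.
- case: b hy => hy; [left | right].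
    by exists x, y; right; rewrite hy addr0.
  by exists x, (y - c%:Z); right; rewrite rmorphB /= hy addrK subrK.
Qed.

Lemma plane_pattern_inj e f e' f' : (0 < a)%N -> (0 < c)%N ->
  plane_pattern e f = plane_pattern e' f' -> e =1 e' /\ f =1 f'.
Proof.
move=> a_gt0 c_gt0 eqP'; split=> z.
  have [y yz] := intr_surj z; have [x xz] := intr_surj (e z).
  have : plane_pattern e' f' ((x, y), (x + a%:Z, y)).
    by rewrite -eqP'; exists x, y; left; rewrite xz yz.
  move=> [x' [y' [[h]|[h]]]] [xE yE *]; first by rewrite -xz xE h -yE yz.
  by exfalso; lia.
have [x xz] := intr_surj z; have [y yz] := intr_surj (f z).
have : plane_pattern e' f' ((x, y), (x, y + c%:Z)).
  by rewrite -eqP'; exists x, y; right; rewrite xz yz.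
move=> [x' [y' [[h]|[h]]]] [xE yE *]; last by rewrite -yz yE h -xE xz.
by exfalso; lia.
Qed.

Lemma strandE (P : set stitch) (S : set gridpoint) p : S p ->
  (forall q r, S q -> edge P q r -> S r) ->
  (forall q, S q -> clos_refl_trans gridpoint (edge P) p q) ->
  [set q | clos_refl_trans gridpoint (edge P) p q] = S.
Proof.
move=> Sp closedS reachS; apply/seteqP; split=> q; last exact: reachS.
move=> /= pq.
elim: pq Sp {reachS} => // [u v uv /closedS|u v w _ IHu _ IHv Su]; first exact.
exact/IHv/IHu.
Qed.

End PlanePatterns.

Section Reduction.
Local Open Scope classical_set_scope.
Local Open Scope ring_scope.
Import GRing.Theory.

(** The labels of a pattern are periodic.  Two rows congruent modulo M contain
    endpoints in the same columns, by the endpoint condition for the vertical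
    labels, and a two-element set {u, u + w} of residues determines u as long as
    2 w is nonzero: stitches and gaps must have different lengths. *)
Lemma hitomezashiE (a b c d : nat) (P : set stitch) :
  (a + b = c + d)%N ->
  a%:R + a%:R <> 0 :> 'Z_(a + b) -> c%:R + c%:R <> 0 :> 'Z_(a + b) ->
  hitomezashi a b c d P <-> exists e f : 'Z_(a + b) -> 'Z_(a + b),
    compat a%:R c%:R e f /\ P = plane_pattern a c e f.
Proof.
move=> eqM a2 c2.
rewrite /hitomezashi /hstitches /vstitches -eqM.
move: (a + b)%N a2 c2 {eqM} => M a2 c2.
pose hst (eps : int -> 'Z_M) : set stitch := [set s | exists i k : int,
     k%:~R = eps i /\ s = ((k, i), (k + a%:Z, i))].
pose vst (eta : int -> 'Z_M) : set stitch := [set s | exists j k : int,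
     k%:~R = eta j /\ s = ((j, k), (j, k + c%:Z))].
have hstE eps (x y : int) : endpoints (hst eps) (x, y) <->
    (x%:~R = eps y \/ x%:~R = eps y + a%:R).
  split.
    move=> [s [i [k [h ->]]]] /= [] [-> ->]; first by left.
    by right; rewrite intrD h.
  case=> h; first by exists ((x, y), (x + a%:Z, y)); [exists y, x | left].
  exists ((x - a%:Z, y), (x, y)); last by right.
  by exists y, (x - a%:Z); rewrite rmorphB /= h addrK subrK.
have vstE eta (x y : int) : endpoints (vst eta) (x, y) <->
    (y%:~R = eta x \/ y%:~R = eta x + c%:R).
  split.
    move=> [s [i [k [h ->]]]] /= [] [-> ->]; first by left.
    by right; rewrite intrD h.
  case=> h; first by exists ((x, y), (x, y + c%:Z)); [exists x, y | left].
  exists ((x, y - c%:Z), (x, y)); last by right.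
  by exists x, (y - c%:Z); rewrite rmorphB /= h addrK subrK.
have pair_inj (u v w : 'Z_M) : w + w <> 0 ->
    (forall x : int, (x%:~R = u \/ x%:~R = u + w) -> (x%:~R = v \/ x%:~R = v + w)) -> u = v.
  move=> w2 sub.
  have [x xu] := intr_surj u; have [x' xu'] := intr_surj (u + w).
  have := sub x (or_introl xu); rewrite xu => -[//|uE].
  have := sub x' (or_intror xu'); rewrite xu' uE.
  by rewrite -addrA => -[/addr_eql|/addrI/addr_eql/(double_neq0 w2)].
split.
  move=> [eps [eta [-> vh hv]]].
  have ef (x y : int) : (x%:~R = eps y \/ x%:~R = eps y + a%:R) <->
      (y%:~R = eta x \/ y%:~R = eta x + c%:R).
    rewrite -hstE -vstE; split; [exact: hv | exact: vh].
  (* evaluate the labels at the least nonnegative representatives *)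
  pose lift (z : 'Z_M) := (z : nat)%:Z.
  have liftK (z : 'Z_M) : (lift z)%:~R = z by exact: natr_Zp.
  have eps_lift y : eps (lift y%:~R) = eps y.
    by apply: pair_inj a2 _ => x /(ef _ _).1; rewrite liftK => /(ef _ _).2.
  have eta_lift x : eta (lift x%:~R) = eta x.
    by apply: pair_inj c2 _ => y /(ef _ _).2; rewrite liftK => /(ef _ _).1.
  exists (eps \o lift), (eta \o lift); split.
    by move=> i j; have := ef (lift j) (lift i); rewrite !liftK.
  apply/seteqP; split=> s.
    case=> -[i [k [h ->]]].
      by exists k, i; left; rewrite /= eps_lift.
    by exists i, k; right; rewrite /= eta_lift.
  move=> [x [y [[/= h ->]|[/= h ->]]]]; [left | right].
    by exists y, x; rewrite h eps_lift.
  by exists x, y; rewrite h eta_lift.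
move=> [e [f [ef ->]]].
exists (fun y => e y%:~R), (fun x => f x%:~R); split.
- apply/seteqP; split=> s.
    by move=> [x [y [h|h]]]; [left; exists y, x | right; exists x, y].
  by case=> -[i [k h]]; [exists k, i; left | exists i, k; right].
- by move=> [x y] /vstE/ef h; exact/hstE.
- by move=> [x y] /hstE/ef h; exact/vstE.
Qed.

End Reduction.

(** * Strands of rectangular patterns *)

Section Rect.
Set Implicit Arguments.
Unset Strict Implicit.
Local Open Scope classical_set_scope.
Local Open Scope ring_scope.
Import Order.TTheory GRing.Theory Num.Theory.

(** Unfolds the cyclic structure of a rectangle, given as the list of its vertices. *)
Lemma next_prev4 (T : eqType) (p0 p1 p2 p3 : T) :
  let s := [:: p0; p1; p2; p3] in uniq s ->
  [/\ (next s p0 = p1) * (prev s p0 = p3), (next s p1 = p2) * (prev s p1 = p0),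
      (next s p2 = p3) * (prev s p2 = p1) & (next s p3 = p0) * (prev s p3 = p2)]%type.
Proof.
rewrite /= !inE !negb_or => /and4P[/and3P[n01 n02 n03] /andP[n12 n13] n23 _].
have ne := (negbTE n01, negbTE n02, negbTE n03, negbTE n12, negbTE n13, negbTE n23).
by split; split; rewrite ?eqxx ?ne //= ?[p1 == p0]eq_sym ?[p2 == p0]eq_sym ?[p3 == p0]eq_sym
  ?[p2 == p1]eq_sym ?[p3 == p1]eq_sym ?[p3 == p2]eq_sym ?ne ?eqxx.
Qed.

Context {M : nat} (a c : nat) (a_gt0 : (0 < a)%N) (c_gt0 : (0 < c)%N).
Context (a2 : a%:R + a%:R <> 0 :> 'Z_M).
Context (c2 : c%:R + c%:R <> 0 :> 'Z_M).
Implicit Types (e f : 'Z_M -> 'Z_M) (x y m n : int) (p q : gridpoint).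

Definition square x y : seq gridpoint :=
  [:: (x, y); (x + a%:Z, y); (x + a%:Z, y + c%:Z); (x, y + c%:Z)].

Lemma square_uniq x y : uniq (square x y).
Proof. by rewrite /= !inE !xpair_eqE; lia. Qed.

Section Pattern.
Context (e f : 'Z_M -> 'Z_M).
Context (ef : compat a%:R c%:R e f).
Context (rect : rectangular a%:R e f).
Local Notation P := (plane_pattern a c e f).

(** The four vertices are respectively west and south, east and south, east and
    north, west and north ends of their stitches, because rectangularity
    transfers the labels of the corner to the other rows and columns. *)
Lemma square_edges x y p q : corner e f x%:~R y%:~R -> p \in square x y ->
  edge P p q <-> q = next (square x y) p \/ q = prev (square x y) p.
Proof.
move=> [xe yf].
have rect' := rectangular_sym a2 ef rect.
have [n0 n1 n2 n3] := next_prev4 (square_uniq x y).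
have edgeP := edge_plane _ a_gt0 c_gt0 (double_neq0 a2) (double_neq0 c2).
rewrite !inE => /or4P[] /eqP ->; rewrite ?n0 ?n1 ?n2 ?n3.
- by rewrite (edgeP e f x y true true) ?addr0.
- rewrite (edgeP e f _ y false true) ?intrD ?addr0 ?addrK ?intr_nat.
  + by rewrite or_comm.
  + by rewrite -xe.
  + by rewrite xe -rect -xe.
- rewrite (edgeP e f _ _ false false) ?addrK // ?intrD ?intr_nat.
  + by rewrite yf -rect' -yf -xe.
  + by rewrite xe -rect -xe -yf.
- rewrite (edgeP e f _ _ true false) ?addrK ?intrD ?addr0 ?intr_nat.
  + by rewrite or_comm.
  + by rewrite yf -rect' -yf.
  + by rewrite -yf.
Qed.

(** Move west by a from an east end, and south by c from a north end. *)
Lemma square_corner_ex p : endpoints P p ->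
  exists x y, corner e f x%:~R y%:~R /\ p \in square x y.
Proof.
case: p => x y /(endpoints_plane _ _ ef) hx.
have /ef hy := hx.
have shift := rectangular_shift _ a2 ef rect.
case: hx => hx; case: hy => hy.
- by exists x, y; rewrite inE eqxx.
- exists x, (y - c%:Z); rewrite !inE ?subrK eqxx !orbT rmorphB /=.
  have -> : y%:~R - c%:Z%:~R = f x%:~R by rewrite hy addrK.
  by split=> //; split=> //; rewrite hx; have [_] := shift y%:~R.
- exists (x - a%:Z), y; rewrite !inE ?subrK eqxx !orbT rmorphB /=.
  have -> : x%:~R - a%:Z%:~R = e y%:~R by rewrite hx addrK.
  by split=> //; split=> //; rewrite rect -hx.
- exists (x - a%:Z), (y - c%:Z); rewrite !inE ?subrK eqxx !orbT !rmorphB /=.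
  have -> : x%:~R - a%:Z%:~R = e y%:~R by rewrite hx addrK.
  have -> : y%:~R - c%:Z%:~R = f x%:~R by rewrite hy addrK.
  by rewrite hx -rect; split=> //; split=> //; have [_ ->] := shift y%:~R.
Qed.

Lemma square_strand x y p : corner e f x%:~R y%:~R -> p \in square x y ->
  [set q | clos_refl_trans gridpoint (edge P) p q] = [set q | q \in square x y].
Proof.
move=> xy pin; apply: strandE => // [q r /= qin|q /= qin].
  by rewrite (square_edges _ xy qin) => -[] ->; rewrite ?mem_next ?mem_prev.
have [n0 n1 n2 n3] := next_prev4 (square_uniq x y).
have step u : u \in square x y ->
    clos_refl_trans gridpoint (edge P) u (next (square x y) u).
  by move=> uin; apply: rt_step; apply/(square_edges _ xy uin); left.
have := (step (x, y), step (x + a%:Z, y), step (x + a%:Z, y + c%:Z),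
         step (x, y + c%:Z)).
rewrite n0 n1 n2 n3 !inE !eqxx !orbT.
move=> -[[[]]] /(_ isT) s01 /(_ isT) s12 /(_ isT) s23 /(_ isT) s30.
apply: (rt_trans _ _ _ (x, y)).
  by move: pin; rewrite !inE => /or4P[] /eqP ->; eauto using rt_trans, rt_refl.
by move: qin; rewrite !inE => /or4P[] /eqP ->; eauto using rt_trans, rt_refl.
Qed.

Lemma square_rectangle x y : corner e f x%:~R y%:~R ->
  rectangle P [set q | q \in square x y].
Proof.
move=> xy; have xyin : (x, y) \in square x y by rewrite inE eqxx.
split.
  exists (x, y); last by rewrite (square_strand xy xyin).
  by apply/endpoints_plane => //; left; case: xy.
exists (square x y); split=> //; first exact: square_uniq.
by move=> u v; exact: square_edges.
Qed.

Lemma rectangular_strand S : strand P S ->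
  exists x y, corner e f x%:~R y%:~R /\ S = [set p | p \in square x y].
Proof.
move=> [p /square_corner_ex [x [y [xy pin]]] ->].
by exists x, y; rewrite (square_strand xy pin).
Qed.

Lemma rectangular_all_rectangles : all_rectangles P.
Proof. by move=> S /rectangular_strand [x [y [xy ->]]]; exact: square_rectangle. Qed.

(** Links the corners of strands in the plane with the points of the torus that
    the parameterization lists. *)
Lemma sw_corners_plane :
  sw_corners P = [set p | corner e f p.1%:~R p.2%:~R].
Proof.
apply/seteqP; split=> -[x y].
  move=> [S [/rectangular_strand [x' [y' [xy ->]]] _]] [/= + min].
  have /min /= : (x', y') \in square x' y' by rewrite inE eqxx.
  move=> hmin; rewrite !inE !xpair_eqE => hp.
  by have [-> ->] : x = x' /\ y = y' by lia.
move=> /= xy; exists [set q | q \in square x y]; first exact: square_rectangle.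
split=> [|[x' y']] /=; first by rewrite inE eqxx.
by rewrite !inE !xpair_eqE; lia.
Qed.

End Pattern.
End Rect.

(** * Strands of zig-zag patterns *)

Section Zigzag.
Set Implicit Arguments.
Unset Strict Implicit.
Local Open Scope classical_set_scope.
Local Open Scope ring_scope.
Import Order.TTheory GRing.Theory Num.Theory.

Context {M : nat} (a c : nat) (a_gt0 : (0 < a)%N) (c_gt0 : (0 < c)%N).
Context (a2 : a%:R + a%:R <> 0 :> 'Z_M).
Context (c2 : c%:R + c%:R <> 0 :> 'Z_M).
Context (up : bool) (e f : 'Z_M -> 'Z_M).
Context (ef : compat a%:R c%:R e f).
Context (zz : zigzag_pattern up a%:R c%:R e f).
Local Notation P := (plane_pattern a c e f).
Implicit Types (x y m n k : int) (p q : gridpoint).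
Local Notation c' := (orient up c%:Z).

Lemma intr_orient : c'%:~R = orient up c%:R :> 'Z_M.
Proof. by rewrite /orient; case: up => //; rewrite rmorphN. Qed.

(** The steps of a zig-zag, continued in both directions. *)
Lemma zigzag_shift i k : e (i + c'%:~R *~ k) = e i + a%:R *~ k.
Proof.
have step (j : 'Z_M) (n : nat) : e (j + c'%:~R *+ n) = e j + a%:R *+ n.
  rewrite intr_orient.
  by have [] := zigzag_row_iter n a2 (orient_double (up := up) c2)
                                (compat_orient up ef) (zz j).
case: k => n; first exact: step.
rewrite !NegzE !mulrNz -!pmulrn.
by apply: (addIr (a%:R *+ n.+1)); rewrite -step !subrK.
Qed.

(** The traversal that starts at the west vertex (x, y): even positions are west
    vertices, odd positions the east vertices of the same rows. *)
Definition walk x y n : gridpoint :=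
  (x + ((n %/ 2)%Z + (n %% 2)%Z) * a%:Z, y + (n %/ 2)%Z * c').

Lemma walk_even x y m : walk x y (2 * m) = (x + m * a%:Z, y + m * c').
Proof.
have [q0 r0] : ((2 * m) %/ 2)%Z = m /\ ((2 * m) %% 2)%Z = 0 by lia.
by rewrite /walk q0 r0 addr0.
Qed.

Lemma walk_odd x y m :
  walk x y (2 * m + 1) = (x + (m + 1) * a%:Z, y + m * c').
Proof.
have [q1 r1] : ((2 * m + 1) %/ 2)%Z = m /\ ((2 * m + 1) %% 2)%Z = 1 by lia.
by rewrite /walk q1 r1.
Qed.

Lemma int_even_odd n : exists m, n = 2 * m \/ n = 2 * m + 1.
Proof. by exists (n %/ 2)%Z; lia. Qed.

(** At a west end (l = true) the vertical stitch comes from the preceding row of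
    the zig-zag, at an east end it leads to the following row. *)
Lemma zigzag_edge x y (l : bool) q :
  x%:~R = e y%:~R + (if l then 0 else a%:R) ->
  edge P (x, y) q <->
  q = (x + (if l then a%:Z else - a%:Z), y) \/ q = (x, y + (if l then - c' else c')).
Proof.
move=> hx.
rewrite (edge_plane (b := if l then ~~ up else up) q a_gt0 c_gt0
           (double_neq0 a2) (double_neq0 c2) hx).
  by rewrite /orient; case: l {hx}; case: up => //=; rewrite opprK.
have [] := zz y%:~R; rewrite /orient /orient_label.
case: l hx => /=; rewrite ?addr0 => ->; case: up => /= hL hR; rewrite ?addr0 //.
by rewrite addrK in hL.
Qed.

Lemma walk_edge x y n q : x%:~R = e y%:~R ->
  edge P (walk x y n) q <-> q = walk x y (n + 1) \/ q = walk x y (n - 1).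
Proof.
move=> xL.
have rowL m : (x + m * a%:Z)%:~R = e (y + m * c')%:~R.
  by rewrite !intrD !intrM xL !mulrzl zigzag_shift.
have [m [->|->]] := int_even_odd n.
  have -> : 2 * m - 1 = 2 * (m - 1) + 1 by lia.
  rewrite !walk_odd walk_even (zigzag_edge (l := true)) ?addr0 //.
  by rewrite subrK !mulrDl mul1r mulN1r !addrA.
have -> : 2 * m + 1 + 1 = 2 * (m + 1) by lia.
rewrite addrK !walk_even walk_odd (zigzag_edge (l := false)).
  by rewrite !mulrDl !mul1r !addrA addrK or_comm.
by rewrite mulrDl mul1r addrA -rowL !intrD.
Qed.

Lemma walk_strand x y p : x%:~R = e y%:~R -> range (walk x y) p ->
  [set q | clos_refl_trans gridpoint (edge P) p q] = range (walk x y).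
Proof.
move=> xL [n _ <-]; apply: strandE; first by exists n.
  by move=> _ r [m _ <-] /(walk_edge _ _ xL) [] ->; [exists (m + 1) | exists (m - 1)].
move=> _ [m _ <-]; rewrite -(subrK n m) addrC; move: (m - n) => {}m.
have fwd k : clos_refl_trans gridpoint (edge P) (walk x y k) (walk x y (k + 1)).
  by apply: rt_step; apply/(walk_edge _ _ xL); left.
have bwd k : clos_refl_trans gridpoint (edge P) (walk x y k) (walk x y (k - 1)).
  by apply: rt_step; apply/(walk_edge _ _ xL); right.
elim/int_ind: m => [|k IHk|k IHk]; first by rewrite addr0; exact: rt_refl.
  apply: rt_trans IHk _; have -> : n + k.+1%:Z = n + k%:Z + 1 by lia.
  exact: fwd.
apply: rt_trans IHk _; have -> : n + (- k.+1%:Z) = n - k%:Z - 1 by lia.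
exact: bwd.
Qed.

Lemma walk_infinite x y : infinite_set (range (walk x y)).
Proof.
pose g (n : nat) := walk x y (2 * n%:Z).
have g_inj : {in [set: nat] &, injective g}.
  move=> n n' _ _; rewrite /g !walk_even => -[/addrI/mulIf + _] => inj.
  by have [] : n%:Z = n'%:Z by apply: inj; lia.
apply: (@sub_infinite_set _ (range g)); first by move=> _ [n _ <-]; exists (2 * n%:Z).
by rewrite (eq_finite_set (inj_card_eq g_inj)); exact: infinite_nat.
Qed.

(** Every vertex is a west end, at position 0 of the walk that starts there, or an
    east end, at position 1 of the walk that starts at its western neighbour. *)
Lemma zigzag_strand S : strand P S -> zigzag up P S.
Proof.
move=> strS; have [[x y] /(endpoints_plane _ _ ef) hx SE] := strS.
have [x0 [xL SE']] : exists x0, x0%:~R = e y%:~R /\ S = range (walk x0 y).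
  case: hx => hx.
    exists x; split=> //; rewrite SE; apply: walk_strand => //; exists 0 => //.
    by rewrite -(mulr0 2) walk_even !mul0r !addr0.
  have xL : (x - a%:Z)%:~R = e y%:~R by rewrite rmorphB /= hx addrK.
  exists (x - a%:Z); split=> //; rewrite SE; apply: walk_strand => //; exists 1 => //.
  by rewrite -[1](add0r 1) -{1}(mulr0 2) walk_odd add0r mul1r mul0r addr0 subrK.
split=> //; first by rewrite SE'; exact: walk_infinite.
exists (walk x0 y); split=> // [n q|m|m].
- exact: walk_edge.
- by rewrite walk_odd walk_even; split=> //=; rewrite mulrDl; lia.
- have -> : 2 * m + 2 = 2 * (m + 1) by lia.
  by rewrite walk_odd walk_even /orient; case: up; split=> //=; rewrite mulrDl; lia.
Qed.

Lemma zigzag_all_zigzags : all_zigzags_single_type P.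
Proof. by exists up => S; exact: zigzag_strand. Qed.

(** Its strands are infinite.  This keeps the two families of patterns disjoint
    when they are counted. *)
Lemma zigzag_not_rectangles : ~ all_rectangles P.
Proof.
move=> rectP; have [x x0] := intr_surj (e 0).
pose S := [set q | clos_refl_trans gridpoint (edge P) (x, 0) q].
have strS : strand P S by exists (x, 0) => //; apply/endpoints_plane => //; left.
have [_ inf _] := zigzag_strand strS.
have [_ [s [_ _ SE _]]] := rectP _ strS.
apply: inf; rewrite SE; exact: finite_seq.
Qed.

End Zigzag.

(** * Choosing every other point of each coset *)

Section Classes.
Set Implicit Arguments.
Unset Strict Implicit.
Local Open Scope ring_scope.
Import GRing.Theory.
Context {M : nat} (M_gt1 : (1 < M)%N) (a : nat).
Local Notation q := (addorder M a).
Local Notation g := (M %/ addorder M a)%N.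
Implicit Types (u : {ffun 'I_g -> bool}) (k l : nat).

Lemma addorderE : q = (M %/ gcdn M a)%N.
Proof.
rewrite /addorder -FinRing.zmodXgE orderXgcd -[1]/(Zp1 : 'Z_M).
by rewrite order_Zp1 Zp_cast.
Qed.

(** The number of cosets of the subgroup spanned by a; their representatives are
    1, ..., M / q. *)
Lemma divn_addorder : g = gcdn M a.
Proof. by rewrite addorderE divnA ?dvdn_gcdl // mulKn // ltnW. Qed.

Lemma divn_addorder_mul : (g * q = M)%N.
Proof. by rewrite divn_addorder addorderE mulnC divnK // dvdn_gcdl. Qed.

Lemma natr_Zp_eqP k l : (k%:R = l%:R :> 'Z_M) <-> k = l %[mod M].
Proof.
split=> [/(congr1 val)|kl]; first by rewrite /= !val_Zp_nat.
by apply: val_inj; rewrite /= !val_Zp_nat.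
Qed.

Lemma mulrn_addorder_eqP k l : (a%:R *+ k = a%:R *+ l :> 'Z_M) <-> k = l %[mod q].
Proof.
rewrite -!FinRing.zmodXgE.
by split=> [/eqP|/eqP]; rewrite ?eq_expg_mod_order => h; apply/eqP;
  rewrite ?eq_expg_mod_order.
Qed.

Lemma mulrn_addorder_eq0 k : (a%:R *+ k = 0 :> 'Z_M) <-> (q %| k)%N.
Proof. by rewrite -(mulr0n (a%:R : 'Z_M)) mulrn_addorder_eqP mod0n; split=> /eqP. Qed.

(** The k-th point of the i-th coset of the subgroup spanned by a, in the numbering
    of the parameterization, where representatives start from 1. *)
Definition class_point (i k : nat) : 'Z_M := i.+1%:R + a%:R *+ k.

(** Reduction modulo gcd (M, a) kills the multiples of a and separates the
    representatives. *)
Lemma class_point_inj (i i' : 'I_g) k k' :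
  class_point i k = class_point i' k' -> i = i' /\ k = k' %[mod q].
Proof.
move=> h; have ii' : i = i'.
  apply: ord_inj; move: h; rewrite /class_point -!mulrnA -!natrD => /natr_Zp_eqP h.
  have gM : (g %| M)%N by rewrite divn_addorder dvdn_gcdl.
  have ga l : (a * l = 0 %[mod g])%N.
    by rewrite mod0n; apply/eqP; rewrite -/(dvdn _ _) dvdn_mulr // divn_addorder dvdn_gcdr.
  have := congr1 (modn^~ g) h; rewrite /= !modn_dvdm //.
  rewrite -[LHS]modnDmr ga modnDmr addn0 -[RHS]modnDmr ga modnDmr addn0.
  rewrite -[in LHS]add1n -[in RHS]add1n.
  by move/eqP; rewrite eqn_modDl !modn_small // => /eqP.
by split=> //; move: h; rewrite ii' => /addrI/mulrn_addorder_eqP.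
Qed.

(** Injectivity and a count: there are M / q cosets with q points each. *)
Lemma class_point_surj (z : 'Z_M) : exists (i : 'I_g) k, z = class_point i k.
Proof.
pose F (ik : 'I_g * 'I_q) := class_point ik.1 ik.2.
have F_inj : injective F.
  move=> [i k] [i' k'] /class_point_inj [/= -> /eqP].
  by rewrite !modn_small // => /eqP/ord_inj ->.
have : (#|{: 'Z_M}| <= #|{: 'I_g * 'I_q}|)%N.
  by rewrite card_prod !card_ord divn_addorder_mul Zp_cast.
by move=> /(inj_card_onto F_inj)/(_ z)/codomP [[i k] ->]; exists i, k.
Qed.

Context (q_even : ~~ odd q).

(** The residues listed by the concatenated sequence of the parameterization: from
    each coset every other point, the bit u i telling which half. *)
Definition half_classes u : seq 'Z_M := [seq x%:~R | x <- tilde u].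

(** The parity of k makes sense modulo q because q is even. *)
Lemma mem_half_classes u (i : 'I_g) k :
  (class_point i k \in half_classes u) = (odd k == u i).
Proof.
apply/idP/eqP.
  move=> /mapP [x /flatten_mapP [j _ /mapP [l _ ->]]].
  have -> : (j.+1 + (u j + 2 * l) * a)%N%:Z%:~R = class_point j (u j + 2 * l).
    by rewrite /class_point -mulrnA -natrD mulnC.
  move=> /class_point_inj [-> kl].
  rewrite -(odd_mod k (negbTE q_even)) kl odd_mod ?(negbTE q_even) //.
  by rewrite mul2n oddD odd_double addbF; case: (u j).
move=> uk; pose l := ((k - u i)./2 %% (q %/ 2))%N.
have q_gt0 : (0 < q)%N by exact: order_gt0.
have q2 : (q %/ 2).*2 = q by lia.
have u_le : (u i <= k)%N by lia.
apply/mapP; exists (i.+1 + (u i + 2 * l) * a)%N%:Z.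
  apply/flatten_mapP; exists i; first exact: mem_enum.
  apply/mapP; exists l => //; rewrite mem_iota /= add0n ltn_mod; lia.
rewrite -pmulrn natrD mulnC mulrnA; congr (_ + _); apply/mulrn_addorder_eqP.
have -> : k = (u i + 2 * (k - u i)./2)%N by lia.
have half_mod m t : t.*2 = q -> (2 * (m %% t) = 2 * m %[mod q])%N.
  by move=> <-; rewrite -mul2n -!muln_modr modn_mod.
apply/eqP; rewrite eqn_modDl; apply/eqP; rewrite [RHS]half_mod //; lia.
Qed.

Lemma half_classes_alternating u :
  alternating a%:R (fun z => z \in half_classes u).
Proof.
move=> z; have [i [k ->]] := class_point_surj z.
have -> : class_point i k + a%:R = class_point i k.+1.
  by rewrite /class_point -addrA -mulrSr.
by rewrite !mem_half_classes /=; case: (odd k) (u i) => -[].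
Qed.

(** On a coset an alternating set is determined by whether it contains the
    representative, which is what the bit records. *)
Lemma half_classes_ex (U : pred 'Z_M) : alternating a%:R U ->
  exists u, U =1 (fun z => z \in half_classes u).
Proof.
move=> altU; exists [ffun i : 'I_g => ~~ U i.+1%:R] => z.
have [i [k ->]] := class_point_surj z.
rewrite mem_half_classes ffunE /class_point (alternatingMn _ _ altU).
by case: (odd k) (U _) => -[].
Qed.

Lemma half_classes_inj u u' : half_classes u =i half_classes u' -> u = u'.
Proof.
move=> uu'; apply/ffunP => i; have := uu' (class_point i 0).
by rewrite !mem_half_classes; case: (u i) (u' i) => -[].
Qed.

Lemma size_half_classes u : size (half_classes u) = (M %/ 2)%N.
Proof.
rewrite size_map size_allpairs size_iota size_enum_ord.
by rewrite -[in RHS]divn_addorder_mul muln_divA // dvdn2.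
Qed.

(** The set of residues listed and its translate by a are complementary, so it has
    M / 2 elements, as many as the list has entries. *)
Lemma half_classes_uniq u : uniq (half_classes u).
Proof.
apply/card_uniqP; rewrite size_half_classes.
pose U := [set z | z \in half_classes u].
have altU := half_classes_alternating u.
(* U alternates, so translation by a exchanges U with its complement *)
have UC : (fun z => z + a%:R) @: U = ~: U.
  apply/setP => z; rewrite !inE -(altU z) /=; apply/imsetP/idP => [[w]|].
    by rewrite inE => wU ->; rewrite altU /= altU /= negbK.
  rewrite (altU z) => zU; exists (z - a%:R); last by rewrite subrK.
  by rewrite inE; have := alternatingB z altU; rewrite /= zU.
have cU : (#|U| + #|U| = M)%N.
  rewrite -{2}(card_imset _ (addIr a%:R)) UC cardsC.
  by rewrite [#|_|]card_ord Zp_cast.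
have -> : #|half_classes u| = #|U| by apply: eq_card => z; rewrite inE.
lia.
Qed.

End Classes.

(** * Parameters of rectangular patterns *)

Section Params.
Set Implicit Arguments.
Unset Strict Implicit.
Local Open Scope classical_set_scope.
Local Open Scope ring_scope.
Import Order.TTheory GRing.Theory Num.Theory.
Context {M : nat} (M_gt1 : (1 < M)%N) (a c : nat).
Implicit Types (x : param M a c) (i j : 'Z_M) (e f : 'Z_M -> 'Z_M).

(** The residues of the corners prescribed by a parameter. *)
Definition param_corner x j i : Prop :=
  let: (u, v, sigma) := x in
  exists l : 'I_(M %/ 2),
    j = (half_classes u)`_l /\ i = (half_classes v)`_(sigma l).

Lemma intr_Zp_eqP (m n : int) :
  m%:~R = n%:~R :> 'Z_M <-> exists k, m = n + M%:Z * k.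
Proof.
have M0 : M%:R = 0 :> 'Z_M by apply/(natr_Zp_eqP M_gt1 M 0); rewrite modnn mod0n.
split=> [/eqP|[k ->]]; last by rewrite intrD intrM -[M%:~R]/(M%:R) M0 mul0r addr0.
rewrite -subr_eq0 -rmorphB /= => mn.
have dvdM (k : nat) : (k%:Z%:~R == 0 :> 'Z_M) -> exists t : nat, k = (t * M)%N.
  by move=> /eqP/(natr_Zp_eqP M_gt1 k 0); rewrite mod0n => /eqP/dvdnP.
have [le_nm|lt_mn] := lerP 0 (m - n).
  have : (`|m - n|%N)%:Z%:~R == 0 :> 'Z_M by rewrite gez0_abs.
  by move=> /dvdM [t tE]; exists t%:Z; lia.
have : (`|m - n|%N)%:Z%:~R == 0 :> 'Z_M.
  by rewrite ltz0_abs // rmorphN oppr_eq0.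
by move=> /dvdM [t tE]; exists (- t%:Z); lia.
Qed.

Context (q_even : ~~ odd (addorder M a)).
Context (r_even : ~~ odd (addorder M c)).

Lemma nth_half_classes b (w : {ffun 'I_(M %/ addorder M b) -> bool}) k :
  (half_classes w)`_k = ((tilde w)`_k)%:~R.
Proof.
have [k_lt|k_ge] := ltnP k (size (tilde w)); first exact: nth_map.
by rewrite !nth_default // size_map.
Qed.

Lemma phi_corners_residues x :
  phi_corners x = [set p | param_corner x p.1%:~R p.2%:~R].
Proof.
case: x => [[u v] s]; apply/seteqP; split=> -[x y] /=.
  move=> [l [m [n [-> ->]]]]; exists l.
  by rewrite !nth_half_classes; split; apply/intr_Zp_eqP; [exists m | exists n].
move=> [l []]; rewrite !nth_half_classes => /intr_Zp_eqP [m xE] /intr_Zp_eqP [n yE].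
by exists l, m, n; rewrite xE yE.
Qed.

(** The two lists of half-classes are the left columns and bottom rows, and the
    permutation is the matching between them. *)
Lemma param_pattern x : exists e f,
  [/\ compat a%:R c%:R e f, rectangular a%:R e f &
      forall j i, corner e f j i <-> param_corner x j i].
Proof.
case: x => [[u v] s].
pose xs := half_classes u; pose ys := half_classes v.
(* the bottom rows listed in the order of their left columns *)
pose ys' := [seq ys`_(s l) | l <- enum 'I_(M %/ 2)].
have sz_xs : size xs = (M %/ 2)%N by exact: size_half_classes.
have sz_ys : size ys = (M %/ 2)%N by exact: size_half_classes.
have sz_ys' : size ys' = (M %/ 2)%N by rewrite size_map size_enum_ord.
have u_xs : uniq xs by exact: half_classes_uniq.
have u_ys : uniq ys by exact: half_classes_uniq.
have nth_ys' (l : 'I_(M %/ 2)) : ys'`_l = ys`_(s l).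
  by rewrite (nth_map l) ?size_enum_ord // nth_ord_enum.
have u_ys' : uniq ys'.
  rewrite map_inj_uniq ?enum_uniq // => l l' /eqP.
  by rewrite nth_uniq ?sz_ys // => /eqP/ord_inj/perm_inj.
have ys'E : ys' =i ys.
  have sub : {subset ys' <= ys} by move=> _ /mapP [l _ ->]; rewrite mem_nth ?sz_ys.
  by have [] := uniq_min_size u_ys' sub; rewrite ?sz_ys' ?sz_ys.
have ltl j : j \in xs -> (index j xs < M %/ 2)%N by rewrite -index_mem sz_xs.
pose g j := ys'`_(index j xs); pose h i := xs`_(index i ys').
have gP j : j \in xs -> g j \in ys /\ h (g j) = j.
  move=> jx; rewrite /g /h -ys'E mem_nth ?sz_ys' ?ltl //.
  by rewrite index_uniq ?sz_ys' ?ltl // nth_index.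
have hP i : i \in ys -> h i \in xs /\ g (h i) = i.
  rewrite -ys'E => iy; have lti : (index i ys' < M %/ 2)%N by rewrite -sz_ys' index_mem.
  by rewrite /g /h mem_nth ?sz_xs // index_uniq ?sz_xs // nth_index.
have [e [f [ef rect W]]] := matching_pattern
  (half_classes_alternating M_gt1 q_even u)
  (half_classes_alternating M_gt1 r_even v) gP hP.
exists e, f; split=> // j i; rewrite W /=; split.
  move=> [jx ->]; exists (Ordinal (ltl j jx)).
  by rewrite -nth_ys' /= nth_index.
move=> [l [-> ->]]; rewrite mem_nth ?sz_xs //.
by rewrite /g index_uniq ?sz_xs // nth_ys'.
Qed.

(** Left columns and bottom rows alternate, hence are half-classes for suitable
    bits; the permutation records which bottom row carries the corner in a given
    left column. *)
Lemma pattern_param e f :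
  a%:R + a%:R <> 0 :> 'Z_M -> c%:R + c%:R <> 0 :> 'Z_M ->
  compat a%:R c%:R e f -> rectangular a%:R e f ->
  exists x, forall j i, corner e f j i <-> param_corner x j i.
Proof.
move=> a2 c2 ef rect.
have altV := bottom_alternating a2 c2 ef rect.
have altU := bottom_alternating c2 a2 (compat_sym ef) (rectangular_sym a2 ef rect).
have [u Uu] := half_classes_ex M_gt1 q_even altU.
have [v Vv] := half_classes_ex M_gt1 r_even altV.
pose xs := half_classes u; pose ys := half_classes v.
have sz_xs : size xs = (M %/ 2)%N by exact: size_half_classes.
have sz_ys : size ys = (M %/ 2)%N by exact: size_half_classes.
have u_xs : uniq xs by exact: half_classes_uniq.
have xsP (l : 'I_(M %/ 2)) : e (f xs`_l) = xs`_l.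
  by apply/eqP; have := Uu xs`_l; rewrite /bottom /= mem_nth ?sz_xs.
have f_ys (l : 'I_(M %/ 2)) : f xs`_l \in ys.
  by rewrite -Vv /bottom xsP.
have ltl (l : 'I_(M %/ 2)) : (index (f (xs`_l)%R) ys < M %/ 2)%N.
  by have := f_ys l; rewrite -index_mem sz_ys.
pose s l := Ordinal (ltl l).
have s_inj : injective s.
  move=> l l' /(congr1 val)/= /(congr1 (nth 0 ys)); rewrite !nth_index //.
  move=> /(congr1 e); rewrite !xsP => /eqP.
  by rewrite nth_uniq ?sz_xs // => /eqP/ord_inj.
exists (u, v, perm s_inj) => j i; split=> [[jE iE]|[l [-> ->]]].
  have jx : j \in xs by rewrite -Uu /bottom -iE -jE.
  have lj : (index j xs < M %/ 2)%N by rewrite -sz_xs index_mem.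
  exists (Ordinal lj); rewrite permE /= nth_index //; split=> //.
  by rewrite -iE nth_index // -Vv /bottom -jE -iE.
by rewrite permE /= nth_index //; split; rewrite ?xsP.
Qed.

Lemma param_corner_cols u v s j :
  j \in half_classes u <-> exists i, param_corner (u, v, s) j i.
Proof.
split=> [/(nthP 0) [k]|[i [l [-> _]]]]; rewrite ?mem_nth ?size_half_classes //.
by move=> k_lt <-; exists (half_classes v)`_(s (Ordinal k_lt)), (Ordinal k_lt).
Qed.

Lemma param_corner_rows u v s i :
  i \in half_classes v <-> exists j, param_corner (u, v, s) j i.
Proof.
split=> [/(nthP 0) [k]|[j [l [_ ->]]]]; rewrite ?mem_nth ?size_half_classes //.
move=> k_lt <-; exists (half_classes u)`_((s^-1)%g (Ordinal k_lt)).
by exists ((s^-1)%g (Ordinal k_lt)); rewrite permKV.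
Qed.

(** The corners show the sets of left columns and bottom rows, which give the bits,
    and then, the lists being duplicate-free, the permutation. *)
Lemma param_corner_inj x x' :
  (forall j i, param_corner x j i <-> param_corner x' j i) -> x = x'.
Proof.
case: x x' => [[u v] s] [[u' v'] s'] W.
have uu' : u = u'.
  apply: (half_classes_inj M_gt1 q_even) => j; apply/idP/idP.
    by move=> /(param_corner_cols _ v s) [i /W ji];
       apply/(param_corner_cols _ v' s'); exists i.
  by move=> /(param_corner_cols _ v' s') [i /W ji];
       apply/(param_corner_cols _ v s); exists i.
have vv' : v = v'.
  apply: (half_classes_inj M_gt1 r_even) => i; apply/idP/idP.
    by move=> /(param_corner_rows u _ s) [j /W ji];
       apply/(param_corner_rows u' _ s'); exists j.
  by move=> /(param_corner_rows u' _ s') [j /W ji];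
       apply/(param_corner_rows u _ s); exists j.
move: W; rewrite -{}uu' -{}vv' => W; congr (_, _, _); apply/permP => l.
have [//|l' [/eqP + /eqP]] := (W (half_classes u)`_l (half_classes v)`_(s l)).1.
  by exists l.
rewrite !nth_uniq ?half_classes_uniq ?size_half_classes //.
by move=> /eqP/ord_inj <- /eqP/ord_inj.
Qed.

Lemma card_param :
  #|{: {ffun 'I_(M %/ addorder M a) -> bool} *
       {ffun 'I_(M %/ addorder M c) -> bool} * 'S_(M %/ 2)}| =
  (2 ^ (M %/ addorder M a + M %/ addorder M c) * (M %/ 2)`!)%N.
Proof. by rewrite !card_prod !card_ffun card_Sn card_bool !card_ord expnD. Qed.

End Params.

(** * Zig-zag labellings *)

Section ZigzagTorus.
Set Implicit Arguments.
Unset Strict Implicit.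
Local Open Scope ring_scope.
Import GRing.Theory.

(** When a and c are units, i / orient up c is the number of steps from row 0 to row
    i, and z is the column of the west vertex in row 0. *)
Definition zigzag_e {R : comUnitRingType} (up : bool) (a c z : R) : R -> R :=
  fun i => z + i / orient up c * a.

(** The vertical stitch in column j starts at the east vertex of that column, one
    step east of the west vertex in column j - a; this determines its row.  In the
    descending case it hangs below that row, which lowers its south end by c. *)
Definition zigzag_f {R : comUnitRingType} (up : bool) (a c z : R) : R -> R :=
  fun j => (j - a - z) / a * orient up c + (if up then 0 else - c).

Lemma orient_unit (R : comUnitRingType) (up : bool) (c : R) :
  (orient up c \is a GRing.unit) = (c \is a GRing.unit).
Proof. by case: up; rewrite //= unitrN. Qed.

Lemma zigzag_label (R : comUnitRingType) up (a c z : R) (j : R) :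
  orient_label up c (zigzag_f up a c z) j = (j - a - z) / a * orient up c.
Proof. by rewrite /orient_label /zigzag_f; case: up; rewrite ?addr0 ?subrK. Qed.

(** Write columns as z + l a and rows as multiples k of orient up c.  Row k then has
    its vertices at l = k and l = k + 1, while column l has its vertices at
    k = l - 1 and k = l. *)
Lemma zigzag_patternP (R : comUnitRingType) up (a c z : R) :
  a \is a GRing.unit -> c \is a GRing.unit ->
  compat a c (zigzag_e up a c z) (zigzag_f up a c z) /\
  zigzag_pattern up a c (zigzag_e up a c z) (zigzag_f up a c z).
Proof.
move=> ua uc; have uC : orient up c \is a GRing.unit by rewrite orient_unit.
pose C := orient up c; pose g j := (j - a - z) / a * C.
have gE l : g (z + l * a) = (l - 1) * C.
  by rewrite /g (_ : z + l * a - a - z = (l - 1) * a) ?mulrK //; ring.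
have eE k : zigzag_e up a c z (k * C) = z + k * a by rewrite /zigzag_e mulrK.
have colE j : exists l, j = z + l * a.
  by exists ((j - z) / a); rewrite divrK // addrC subrK.
have rowE i : exists k, i = k * C by exists (i / C); rewrite divrK.
have eg : compat a C (zigzag_e up a c z) g.
  move=> i j; have [[k ->] [l ->]] := (rowE i, colE j); rewrite eE gE.
  rewrite (_ : z + k * a + a = z + (k + 1) * a); last by ring.
  rewrite (_ : (l - 1) * C + C = l * C); last by ring.
  split=> -[]; first by move=> /addrI/(mulIr ua) ->; right.
  - by move=> /addrI/(mulIr ua) ->; left; rewrite addrK.
  - by move=> /(mulIr uC) ->; right; rewrite subrK.
  - by move=> /(mulIr uC) ->; left.
split.
  move=> i j; have := compat_flip eg i j; have := eg i j.
  by rewrite /g /C /zigzag_f; case: (up); rewrite /= ?addr0 ?opprK.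
move=> i; have [k ->] := rowE i; rewrite /zigzag_row !zigzag_label -/(g _) -/(g _) -/C.
rewrite eE gE (_ : z + k * a + a = z + (k + 1) * a); last by ring.
by rewrite gE addrK; split=> //; ring.
Qed.

Lemma Zp_mulrn_ex (M : nat) (c i : 'Z_M) : c \is a GRing.unit -> exists k, i = c *+ k.
Proof. by move=> uc; exists (i / c : 'Z_M); rewrite -mulr_natr natr_Zp mulrC divrK. Qed.

(** When c generates the residues, the strand through one zig-zag row visits every
    row. *)
Lemma zigzag_row_everywhere (M : nat) up (a c : 'Z_M) e f i :
  a + a <> 0 -> c + c <> 0 -> c \is a GRing.unit -> compat a c e f ->
  zigzag_row a (orient up c) e (orient_label up c f) i -> zigzag_pattern up a c e f.
Proof.
move=> a2 c2 uc ef zi j.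
have [k jE] : exists k, j - i = orient up c *+ k.
  by apply: Zp_mulrn_ex; rewrite orient_unit.
rewrite -(subrK i j) addrC jE.
by have [] := zigzag_row_iter k a2 (orient_double (up:=up) c2) (compat_orient up ef) zi.
Qed.

(** The step rule e (i + c) = e i + a, and its mirror image, leave only the label of
    row 0 free. *)
Lemma zigzag_pattern_rigid (M : nat) up (a c : 'Z_M) e f :
  a + a <> 0 -> c + c <> 0 -> a \is a GRing.unit -> c \is a GRing.unit ->
  compat a c e f -> zigzag_pattern up a c e f ->
  e = zigzag_e up a c (e 0) /\ f = zigzag_f up a c (e 0).
Proof.
move=> a2 c2 ua uc ef zz; have uC : orient up c \is a GRing.unit by rewrite orient_unit.
have eE i : e i = zigzag_e up a c (e 0) i.
  have [k iE] := Zp_mulrn_ex i uC.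
  have [+ _] := zigzag_row_iter k a2 (orient_double (up := up) c2)
                                (compat_orient up ef) (zz 0).
  rewrite add0r -iE /zigzag_e iE => ->.
  by rewrite -[X in X / _]mulr_natl mulrK // mulr_natl.
split; apply: funext; first exact: eE.
move=> j.
have uz : j = e ((j - a - e 0) / a * orient up c) + a.
  by rewrite eE /zigzag_e mulrK // divrK //; ring.
have [_] := zz ((j - a - e 0) / a * orient up c).
by rewrite -uz -zigzag_label /orient_label; case: up {zz uC eE uz} => // /addIr.
Qed.

(** Row 0 reveals z; row c is shifted by a or by - a according to the type, and
    these differ. *)
Lemma zigzag_e_inj (R : comUnitRingType) up up' (a c z z' : R) :
  a + a <> 0 -> c \is a GRing.unit ->
  zigzag_e up a c z =1 zigzag_e up' a c z' -> up = up' /\ z = z'.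
Proof.
move=> a2 uc ee; have zz' : z = z'.
  by have := ee 0; rewrite /zigzag_e !mul0r !addr0.
split=> //; have := ee c; rewrite /zigzag_e /orient zz' => /addrI.
have naa : a <> - a by move=> aE; apply: a2; rewrite {1}aE addNr.
case: up {ee}; case: up' => //; rewrite invrN mulrN divrr // mulNr mul1r //.
by move/esym.
Qed.

End ZigzagTorus.

(** * Counting by bijections *)

Section Counting.
Set Implicit Arguments.
Unset Strict Implicit.
Local Open Scope classical_set_scope.
Local Open Scope card_scope.

(** Reduces counting patterns to counting finite parameter types. *)
Lemma card_eq_finType (T : finType) (X : Type) (A : set X) (g : T -> X) :
  set_bij [set: T] A g -> A #= `I_#|T|.
Proof.
move=> [g_fun g_inj g_surj].
have -> : A = g @` setT by apply/seteqP; split=> // _ [t _ <-]; exact: g_fun.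
apply: card_eq_trans (inj_card_eq g_inj) _; rewrite card_eq_sym.
have r_inj : {in [set: T] &, injective (fun t => enum_rank t : nat)}.
  by move=> t t' _ _ /ord_inj/enum_rank_inj.
have -> : `I_#|T| = (fun t : T => enum_rank t : nat) @` setT.
  apply/seteqP; split=> [k /= k_lt|_ [t _ <-]] //=.
  by exists (enum_val (Ordinal k_lt)) => //; rewrite enum_valK.
exact: inj_card_eq.
Qed.

Lemma set_bijU (T T' : Type) (X : Type) (A B : set X) (g : T -> X) (h : T' -> X) :
  A `&` B `<=` set0 -> set_bij [set: T] A g -> set_bij [set: T'] B h ->
  set_bij [set: T + T'] (A `|` B) (fun t => match t with inl u => g u | inr v => h v end).
Proof.
move=> AB [gA gI gS] [hB hI hS]; split.
- by move=> [u|v] _ /=; [left; exact: gA | right; exact: hB].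
- have disj u v : g u <> h v.
    by move=> guhv; apply: (AB (g u)); split; [exact: gA | rewrite guhv; exact: hB].
  move=> [u|v] [u'|v'] _ _ /=.
  + by move=> guu'; congr inl; apply: gI guu'; rewrite inE.
  + by move=> /disj.
  + by move=> /esym/disj.
  + by move=> hvv'; congr inr; apply: hI hvv'; rewrite inE.
- by move=> p [/gS [u _ <-]|/hS [v _ <-]]; [exists (inl u) | exists (inr v)].
Qed.

End Counting.

(** * Classification of hitomezashi patterns *)

Section Main.
Set Implicit Arguments.
Unset Strict Implicit.
Local Open Scope classical_set_scope.
Local Open Scope ring_scope.
Local Open Scope card_scope.
Import GRing.Theory.

Context (a b c d : nat).
Context (a_gt0 : (0 < a)%N) (b_gt0 : (0 < b)%N).
Context (c_gt0 : (0 < c)%N) (d_gt0 : (0 < d)%N).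
Context (neq_ab : a <> b) (neq_cd : c <> d) (eqM : (a + b = c + d)%N).
Local Notation M := (a + b)%N.
Local Notation q := (addorder M a).
Local Notation r := (addorder M c).

Lemma M_gt1 : (1 < M)%N.
Proof. lia. Qed.

Lemma double_natr_neq0 (k l : nat) : (0 < k)%N -> (0 < l)%N -> k <> l ->
  (k + l)%N = M -> k%:R + k%:R <> 0 :> 'Z_M.
Proof.
move=> k_gt0 l_gt0 kl klM; rewrite -natrD => /(natr_Zp_eqP M_gt1 _ 0).
rewrite mod0n => /eqP/dvdnP [t]; rewrite -klM.
(* 2 k = t (k + l) with k, l > 0 leaves only t = 1, that is k = l *)
case: t => [|[|t]]; nia.
Qed.

Lemma double_width_neq0 : a%:R + a%:R <> 0 :> 'Z_M.
Proof. exact: double_natr_neq0 b_gt0 neq_ab _. Qed.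
Local Notation a2 := double_width_neq0.

Lemma double_height_neq0 : c%:R + c%:R <> 0 :> 'Z_M.
Proof. exact: double_natr_neq0 d_gt0 neq_cd (esym eqM). Qed.
Local Notation c2 := double_height_neq0.

Lemma hitomezashi_compat P : hitomezashi a b c d P <-> exists e f : 'Z_M -> 'Z_M,
    compat a%:R c%:R e f /\ P = plane_pattern a c e f.
Proof. exact: (hitomezashiE _ eqM a2 c2). Qed.

Lemma gcdM_a : gcdn M a = gcdn a b.
Proof. by rewrite gcdnC gcdnDl. Qed.

Lemma gcdM_c : gcdn M c = gcdn c d.
Proof. by rewrite eqM gcdnC gcdnDl. Qed.

(** A zig-zag row makes q and r divide the same numbers, so q = r; and gcd (a, b)
    and gcd (c, d) are M / q and M / r. *)
Lemma zigzag_gcd up (e f : 'Z_M -> 'Z_M) (i : 'Z_M) : compat a%:R c%:R e f ->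
  zigzag_row a%:R (orient up c%:R) e (orient_label up c%:R f) i ->
  gcdn a b = gcdn c d.
Proof.
move=> ef zi.
have periods k : (q %| k)%N = (r %| k)%N.
  have step := zigzag_row_periods k a2 (orient_double (up:=up) c2) (compat_orient up ef) zi.
  have oc : orient up c%:R *+ k = 0 :> 'Z_M <-> c%:R *+ k = 0 :> 'Z_M.
    rewrite /orient; case: (up) => //; rewrite mulNrn.
    by split=> [/eqP|->]; rewrite ?oppr0 // oppr_eq0 => /eqP.
  apply/idP/idP; first by move=> /mulrn_addorder_eq0/step/oc/mulrn_addorder_eq0.
  by move=> /mulrn_addorder_eq0/oc/step/mulrn_addorder_eq0.
have qr : q = r by apply/eqP; rewrite eqn_dvd periods dvdnn -periods dvdnn.
by rewrite -gcdM_a -gcdM_c -!(divn_addorder M_gt1) qr.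
Qed.

(** Bottom rows alternate along multiples of c, left columns along multiples of a. *)
Lemma rectangular_even (e f : 'Z_M -> 'Z_M) :
  compat a%:R c%:R e f -> rectangular a%:R e f ->
  ~~ odd q /\ ~~ odd r.
Proof.
move=> ef rect; split.
  have altU := bottom_alternating c2 a2 (compat_sym ef) (rectangular_sym a2 ef rect).
  by apply: alternating_period altU _; apply/mulrn_addorder_eq0.
have altV := bottom_alternating a2 c2 ef rect.
by apply: alternating_period altV _; apply/mulrn_addorder_eq0.
Qed.

Context (gcd1 : gcdn (gcdn a b) (gcdn c d) = 1%N).

(** Two equal coprime numbers are 1. *)
Lemma units_of_gcd : gcdn a b = gcdn c d ->
  a%:R \is a @GRing.unit 'Z_M /\ c%:R \is a @GRing.unit 'Z_M.
Proof.
move=> gab; rewrite !unitZpE ?M_gt1 // /coprime gcdM_a gcdM_c -gab.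
by move: gcd1; rewrite -gab gcdnn => ->.
Qed.

Definition zigzag_arrangement (t : bool * 'Z_M) : set stitch :=
  plane_pattern a c (zigzag_e t.1 a%:R c%:R t.2) (zigzag_f t.1 a%:R c%:R t.2).

(** A row that is not rectangular is a zig-zag row; it forces the two greatest
    common divisors to be equal, hence equal to 1, so that a and c are units and
    the whole pattern is an explicit zig-zag arrangement. *)
Lemma hitomezashi_cases P : hitomezashi a b c d P ->
  (exists e f : 'Z_M -> 'Z_M, [/\ compat a%:R c%:R e f,
     rectangular a%:R e f & P = plane_pattern a c e f]) \/
  (gcdn a b = gcdn c d /\ exists t, P = zigzag_arrangement t).
Proof.
move=> /hitomezashi_compat [e [f [ef ->]]].
have [rect|nrect] := pselect (rectangular a%:R e f); first by left; exists e, f.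
right; have [i ni] : exists i, f (e i) <> f (e i + a%:R).
  by apply/existsNP.
have [//|[up zi]] := row_cases i ef.
have gab := zigzag_gcd ef zi; split=> //; have [ua uc] := units_of_gcd gab.
have zz := zigzag_row_everywhere a2 c2 uc ef zi.
have [eE fE] := zigzag_pattern_rigid a2 c2 ua uc ef zz.
by exists (up, e 0); rewrite /zigzag_arrangement /= -eE -fE.
Qed.

Lemma zigzag_arrangementP t : gcdn a b = gcdn c d ->
  [/\ hitomezashi a b c d (zigzag_arrangement t),
      all_zigzags_single_type (zigzag_arrangement t) &
      ~ all_rectangles (zigzag_arrangement t)].
Proof.
move=> /units_of_gcd [ua uc]; case: t => up z.
have [ef zz] := zigzag_patternP up z ua uc; split.
- by apply/hitomezashi_compat; do 2!eexists; split; first exact: ef.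
- exact: (zigzag_all_zigzags a_gt0 c_gt0 a2 c2 ef zz).
- exact: (zigzag_not_rectangles a_gt0 c_gt0 a2 c2 ef zz).
Qed.

Lemma zigzag_arrangement_bij : gcdn a b = gcdn c d ->
  set_bij [set: bool * 'Z_M]
    [set P | hitomezashi a b c d P /\ ~ all_rectangles P] zigzag_arrangement.
Proof.
move=> gab; split.
- by move=> t _; have [] := zigzag_arrangementP t gab.
- move=> [up z] [up' z'] _ _ /(plane_pattern_inj a_gt0 c_gt0) /= [ee _].
  have [_ uc] := units_of_gcd gab.
  by have [-> ->] := zigzag_e_inj a2 uc ee.
- move=> P [/hitomezashi_cases [[e [f [ef rect ->]]] []|[_ [t ->]] _]]; last by exists t.
  exact: (rectangular_all_rectangles a_gt0 c_gt0 a2 c2 ef rect).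
Qed.

(** Translates the defining properties of phi to the torus, where matchings supply
    a pattern with given corners and the corners determine its labels. *)
Lemma phi_specE (x : param M a c) P : ~~ odd q -> ~~ odd r ->
  phi_spec a b c d x P <-> exists e f : 'Z_M -> 'Z_M,
    [/\ compat a%:R c%:R e f, rectangular a%:R e f,
        P = plane_pattern a c e f &
        forall j i, corner e f j i <-> param_corner x j i].
Proof.
move=> q_even r_even; rewrite /phi_spec phi_corners_residues ?M_gt1 //; split.
  move=> [/hitomezashi_cases [[e [f [ef rect ->]]] _|[gab [t ->]]]]; last first.
    by have [_ _ nrect] := zigzag_arrangementP t gab.
  rewrite (sw_corners_plane a_gt0 c_gt0 a2 c2 ef rect) => WE; exists e, f; split=> // j i.
  have [[x' <-] [y' <-]] := (intr_surj j, intr_surj i).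
  have := congr1 (fun A : set gridpoint => A (x', y')) WE.
  by rewrite /= => ->.
move=> [e [f [ef rect -> W]]]; split.
- by apply/hitomezashi_compat; exists e, f.
- exact: (rectangular_all_rectangles a_gt0 c_gt0 a2 c2 ef rect).
- rewrite (sw_corners_plane a_gt0 c_gt0 a2 c2 ef rect).
  by apply/seteqP; split=> p /=; rewrite W.
Qed.

Lemma phi_spec_unique (x : param M a c) : ~~ odd q -> ~~ odd r ->
  exists! P, phi_spec a b c d x P.
Proof.
move=> q_even r_even.
have [e [f [ef rect W]]] := param_pattern M_gt1 q_even r_even x.
exists (plane_pattern a c e f); split.
  by apply/phi_specE => //; exists e, f.
move=> P /(phi_specE _ _ q_even r_even) [e' [f' [ef' rect' -> W']]].
have WW' j i : corner e f j i <-> corner e' f' j i by rewrite W W'.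
have -> : e = e'.
  by apply: funext; apply: (corners_determine_labels a2 c2 ef rect ef' rect' WW').
(* f is recovered like e, after exchanging rows and columns *)
suff -> : f = f' by [].
apply: funext.
apply: (corners_determine_labels c2 a2
  (compat_sym ef) (rectangular_sym a2 ef rect)
  (compat_sym ef') (rectangular_sym a2 ef' rect')) => i j.
by split=> -[h1 h2]; have [] := WW' j i; rewrite /corner; intuition.
Qed.

Lemma phiP (x : param M a c) : ~~ odd q -> ~~ odd r -> phi_spec a b c d x (phi a b c d x).
Proof.
move=> q_even r_even; have [P [xP _]] := phi_spec_unique x q_even r_even.
rewrite /phi; exact: (xgetPex set0 (ex_intro _ P xP)).
Qed.

Lemma phi_bij : ~~ odd q -> ~~ odd r ->
  set_bij [set: param M a c]
    [set P | hitomezashi a b c d P /\ all_rectangles P] (phi a b c d).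
Proof.
move=> q_even r_even; split.
- by move=> x _; have [] := phiP x q_even r_even.
- move=> x x' _ _ eq_phi.
  have /(phi_specE _ _ q_even r_even) [e [f [ef rect PE W]]] := phiP x q_even r_even.
  have /(phi_specE _ _ q_even r_even) [e' [f' [ef' rect' PE' W']]] := phiP x' q_even r_even.
  apply: (param_corner_inj M_gt1 q_even r_even) => j i; rewrite -W -W'.
  have [ee ff] : e =1 e' /\ f =1 f'.
    by apply: (plane_pattern_inj a_gt0 c_gt0); rewrite -PE -PE'.
  by rewrite /corner ee ff.
- move=> P [/hitomezashi_cases [[e [f [ef rect ->]]] _|[gab [t ->]]]]; last first.
    by have [_ _ nrect] := zigzag_arrangementP t gab.
  have [x W] := pattern_param M_gt1 q_even r_even a2 c2 ef rect.
  exists x => //; have [P' [_ uniqP']] := phi_spec_unique x q_even r_even.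
  rewrite -(uniqP' _ (phiP x q_even r_even)); apply: uniqP'.
  by apply/phi_specE => //; exists e, f.
Qed.

Lemma rectangles_or_zigzags P : hitomezashi a b c d P ->
  [/\ all_rectangles P, ~~ odd q & ~~ odd r] \/
  (gcdn a b = gcdn c d /\ exists t, P = zigzag_arrangement t).
Proof.
move=> /hitomezashi_cases [[e [f [ef rect ->]]]|]; last by right.
have [q_even r_even] := rectangular_even ef rect.
by left; split=> //; exact: (rectangular_all_rectangles a_gt0 c_gt0 a2 c2 ef rect).
Qed.

End Main.

Local Open Scope classical_set_scope.
Local Open Scope card_scope.

Theorem theorem3p8 (a b c d : nat)
    (a_gt0 : (0 < a)%N) (b_gt0 : (0 < b)%N)
    (c_gt0 : (0 < c)%N) (d_gt0 : (0 < d)%N)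
    (gcd1 : gcdn (gcdn a b) (gcdn c d) = 1%N)
    (neq_ab : a <> b) (neq_cd : c <> d) (eqM : (a + b = c + d)%N) :
  let M := (a + b)%N in
  let q := addorder M a in
  let r := addorder M c in
  [/\ (gcdn a b <> gcdn c d -> odd q \/ odd r ->
       ~ exists P, hitomezashi a b c d P),
      (gcdn a b <> gcdn c d -> ~~ odd q /\ ~~ odd r ->
       [/\ (forall P, hitomezashi a b c d P -> all_rectangles P),
           (forall x : param M a c, exists! P, phi_spec a b c d x P),
           set_bij [set: param M a c] [set P | hitomezashi a b c d P]
             (phi a b c d) &
           [set P | hitomezashi a b c d P]
             #= `I_(2 ^ (M %/ q + M %/ r) * (M %/ 2)`!)]),
      (gcdn a b = gcdn c d -> odd q \/ odd r ->
       (forall P, hitomezashi a b c d P -> all_zigzags_single_type P) /\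
       [set P | hitomezashi a b c d P] #= `I_(2 * M)) &
      (gcdn a b = gcdn c d -> ~~ odd q /\ ~~ odd r ->
       [/\ (forall P, hitomezashi a b c d P ->
              all_rectangles P \/ all_zigzags_single_type P),
           (forall x : param M a c, exists! P, phi_spec a b c d x P),
           set_bij [set: param M a c]
             [set P | hitomezashi a b c d P /\ all_rectangles P] (phi a b c d) &
           [set P | hitomezashi a b c d P]
             #= `I_(2 ^ (M %/ q + M %/ r) * (M %/ 2)`! + 2 * M)])].
Proof.
move=> M q r.
have rect_bij := phi_bij a_gt0 b_gt0 c_gt0 d_gt0 neq_ab neq_cd eqM gcd1.
have zig_bij := zigzag_arrangement_bij a_gt0 b_gt0 c_gt0 d_gt0 neq_ab neq_cd eqM gcd1.
have unique := phi_spec_unique a_gt0 b_gt0 c_gt0 d_gt0 neq_ab neq_cd eqM gcd1.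
have dichotomy := rectangles_or_zigzags a_gt0 b_gt0 c_gt0 d_gt0 neq_ab neq_cd eqM gcd1.
have zigP := zigzag_arrangementP a_gt0 b_gt0 c_gt0 d_gt0 neq_ab neq_cd eqM gcd1.
have card_zig : #|{: bool * 'Z_M}| = (2 * M)%N.
  by rewrite card_prod card_bool card_ord Zp_cast // /M; lia.
have no_rect P : odd q \/ odd r -> hitomezashi a b c d P ->
    gcdn a b = gcdn c d /\ exists t : bool * 'Z_(a + b), P = zigzag_arrangement c t.
  move=> odd_qr /dichotomy [[_ /negP q_even /negP r_even]|//].
  by case: odd_qr => [/q_even|/r_even].
split.
- by move=> ngab odd_qr [P /(no_rect _ odd_qr) [gab _]].
- move=> ngab [q_even r_even].
  have allrect P : hitomezashi a b c d P -> all_rectangles P.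
    by move=> /dichotomy [[]|[gab _]].
  have allE : [set P | hitomezashi a b c d P] =
      [set P | hitomezashi a b c d P /\ all_rectangles P].
    by apply/seteqP; split=> [P hP|P []] //; split=> //; exact: allrect.
  split=> // [x||]; rewrite ?allE.
  + exact: unique.
  + exact: rect_bij.
  + by rewrite -card_param; exact: (card_eq_finType (rect_bij q_even r_even)).
- move=> gab odd_qr; split.
    by move=> P /(no_rect _ odd_qr) [_ [t ->]]; have [] := zigP t gab.
  rewrite -card_zig.
  have -> : [set P | hitomezashi a b c d P] =
      [set P | hitomezashi a b c d P /\ ~ all_rectangles P].
    apply/seteqP; split=> [P hP|P []] //; split=> //.
    by have [_ [t ->]] := no_rect _ odd_qr hP; have [] := zigP t gab.
  exact: (card_eq_finType (zig_bij gab)).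
- move=> gab [q_even r_even]; split.
  + move=> P /dichotomy [[]|[_ [t ->]]]; first by left.
    by right; have [] := zigP t gab.
  + by move=> x; exact: unique.
  + exact: rect_bij.
  + have -> : [set P | hitomezashi a b c d P] =
        [set P | hitomezashi a b c d P /\ all_rectangles P] `|`
        [set P | hitomezashi a b c d P /\ ~ all_rectangles P].
      apply/seteqP; split=> [P hP|P [[]|[]]] //.
      by have [rP|nrP] := pselect (all_rectangles P); [left | right].
    rewrite -card_param -card_zig -card_sum.
    apply: (card_eq_finType (set_bijU _ (rect_bij q_even r_even) (zig_bij gab))).
    by move=> P [[_ rP] [_ /(_ rP)]].
Qed.
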